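(* Let $p$ be a prime, let $G=C_p\times C_p$, and let $H_1,H_2,\dots,H_{p+1}$ be the nontrivial, proper subgroups of $G$. For every subset $I\subseteq\{1,2,\dots,p+1\}$, define $N_I=\bigcup_{i\in I}(H_i\setminus\{1\})$. Then for every partition $\mathcal{P}$ of $\{1,2,\dots,p+1\}$, the partition $\{N_I: I\in\mathcal{P}\}$ of $G\setminus\{1\}$ gives the nonidentity superclasses of a supercharacter theory $\mathsf{S}_{\mathcal{P}}$ of $G$.
   Context: A supercharacter theory of a finite group $G$ is a pair $\mathsf{S}=(\mathcal{X},\mathcal{K})$, where $\mathcal{X}$ is a partition of $\mathrm{Irr}(G)$ and $\mathcal{K}$ is a partition of $G$, such that $|\mathcal{X}|=|\mathcal{K}|$, $\{1\}\in\mathcal{K}$, and for every $X\in\mathcal{X}$ there is a (nonzero) character $\xi_X$ whose irreducible constituents lie in $X$ and which is constant on each part of $\mathcal{K}$. The parts of $\mathcal{K}$ are the superclasses. *)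

(* Defs.v *)
From mathcomp Require Import all_boot all_order all_algebra all_fingroup.
From mathcomp Require Import all_solvable all_field all_character.

Set Implicit Arguments.
Unset Strict Implicit.
Unset Printing Implicit Defensive.

Local Open Scope group_scope.

(* Irr(G) is represented by its index type Iirr G (i |-> 'chi_i is a bijection
   onto irr G), so a set of irreducible characters is an element of
   {set Iirr G}.  Character values lie in algC, which contains the values of
   all complex characters of a finite group. *)
Definition supercharacter_theory (gT : finGroupType) (G : {group gT})
    (X : {set {set Iirr G}}) (K : {set {set gT}}) : Prop :=
  [/\ partition X [set: Iirr G],
      partition K G,
      #|X| = #|K|,
      [set 1] \in K
    & forall Y : {set Iirr G}, Y \in X ->
        exists xi : 'CF(G),
          [/\ xi \is a character, xi != 0%R,
              {subset irr_constt xi <= Y}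
            & forall C : {set gT}, C \in K ->
                {in C &, forall x y, xi x = xi y}]].

Arguments supercharacter_theory {gT} G X K.

Definition punctured_union (gT : finGroupType) (n : nat)
    (H : 'I_n -> {group gT}) (I : {set 'I_n}) : {set gT} :=
  \bigcup_(i in I) (H i)^#.

(* Main.v *)
Require Import Defs.
From mathcomp Require Import all_boot all_order all_algebra all_fingroup.
From mathcomp Require Import all_solvable all_field all_character.

Set Implicit Arguments.
Unset Strict Implicit.
Unset Printing Implicit Defensive.

Local Open Scope group_scope.

Import GRing.Theory.

(** The subgroups H_i of order p play two roles. Any two of them meet
    trivially and together they cover G, so every nonidentity element lies in
    exactly one H_i. Dually, a nonprincipal irreducible character chi is
    linear, and G / ker chi is cyclic although G is not, so ker chi is again a
    proper nontrivial subgroup: every nonprincipal character has exactly one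
    H_i as its kernel. A partition P of the index set therefore induces
    partitions of G^# and of the nonprincipal characters, with the same number
    #|P| of parts; adding {1} and the class of the principal character gives
    the candidate superclasses and character classes.

    For the class attached to J in P, the required character is the sum of its
    members. The characters whose kernel contains H_i add up to the
    permutation character of G on G / H_i, which is p on H_i and 0 elsewhere
    ([sum_irr_cfker_sub]); removing the principal one and summing over i in J
    gives a character with value p - #|J| on the nonidentity elements of
    the union of the H_i, i in J, and - #|J| on the other nonidentity elements.
    It is thus constant on each superclass.

    The argument uses only that G is abelian and that the H_i are proper and
    nontrivial, cover G, meet trivially, have the same index, and include the
    kernels of all nonprincipal characters; it is given in this form in
    [subgroup_partition_supercharacter_theory]. *)

Lemma bigcup_partition (I T : finType) (D : I -> {set T}) (P : {set {set I}}) :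
    (forall i j, i != j -> [disjoint D i & D j]) ->
    (forall i, D i != set0) -> partition P [set: I] ->
  partition [set \bigcup_(i in J) D i | J : {set I} in P] (\bigcup_i D i)
    /\ {in P &, injective (fun J : {set I} => \bigcup_(i in J) D i)}.
Proof.
move=> disD ntD /and3P[/eqP coverP tiP P0].
have [| J PJ | partD injD] :=
  indexed_partition (J := mem P) (B := fun J : {set I} => \bigcup_(i in J) D i).
- move=> J1 J2 PJ1 PJ2 neqJ; apply/pred0P=> x /=; apply: contraNF neqJ.
  case/andP=> /bigcupP[i J1i Dix] /bigcupP[j J2j Djx].
  have eq_ij: i = j.
    apply: contraTeq Djx => /disD/pred0P/(_ x)/=.
    by rewrite Dix /= => ->.
  by rewrite -(def_pblock tiP PJ1 J1i) eq_ij (def_pblock tiP PJ2 J2j).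
- have /set0Pn[i Ji]: J != set0 by apply: contraNneq P0 => <-.
  have /set0Pn[x Dix] := ntD i.
  by apply/set0Pn; exists x; apply/bigcupP; exists i.
split=> //; congr partition: partD.
apply/setP=> x; rewrite /cover.
apply/bigcupP/bigcupP=> [[_ /imsetP[J PJ ->]] | [i _ Dix]].
  by case/bigcupP=> i _ Dix; exists i.
have: i \in cover P by rewrite coverP.
case/bigcupP=> J PJ Ji; exists (\bigcup_(i in J) D i); first exact: imset_f.
by apply/bigcupP; exists i.
Qed.

Lemma big_disjoint_bigcup (R : Type) (idx : R) (op : Monoid.com_law idx)
    (I T : finType) (D : I -> {set T}) (J : {pred I}) (E : T -> R) :
    (forall i j, i != j -> [disjoint D i & D j]) ->
  \big[op/idx]_(x in \bigcup_(i in J) D i) E x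
    = \big[op/idx]_(i in J) \big[op/idx]_(x in D i) E x.
Proof.
move=> disD.
rewrite (big_mkcond (fun i => i \in J)) partition_disjoint_bigcup.
  rewrite [RHS]big_mkcond; apply: eq_bigr => i _.
  by case: ifP => // _; rewrite big_set0.
move=> i j neq_ij; case: ifP => _; last by rewrite -setI_eq0 set0I.
by case: ifP => _; [apply: disD | rewrite -setI_eq0 setI0].
Qed.

Lemma irr_constt_sum_irr (gT : finGroupType) (G : {group gT})
    (U : {set Iirr G}) :
  irr_constt (\sum_(k in U) 'chi_k)%R =i U.
Proof.
move=> k; rewrite irr_consttE cfdot_suml.
rewrite (eq_bigr (fun l => (l == k)%:R)%R) => [|l _]; last exact: cfdot_irr.
have [Uk | nUk] := boolP (k \in U).
  by rewrite (bigD1 k) //= eqxx big1 ?addr0 ?oner_neq0 // => l /andP[_ /negPf->].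
by rewrite big1 ?eqxx // => l Ul; rewrite (negPf (memPn nUk l Ul)).
Qed.

(** Both sides are the permutation character of [G] on [G / N]: by Frobenius
    reciprocity, the multiplicity in it of the linear character ['chi_k] is 1
    if ['chi_k] restricts trivially to [N], and 0 otherwise. *)
Lemma sum_irr_cfker_sub (gT : finGroupType) (G N : {group gT}) :
    abelian G -> N \subset G ->
  (\sum_(k : Iirr G | N \subset cfker 'chi_k) 'chi_k
     = #|G : N|%:R *: '1_N :> 'CF(G))%R.
Proof.
move=> abG sNG; have nsNG: N <| G by rewrite -sub_abelian_normal.
rewrite -cfInd_cfun1 // [RHS]cfun_sum_cfdot big_mkcond /=.
apply: eq_bigr => k _; rewrite -Frobenius_reciprocity.
have /char_abelianP/(_ k) lin_k := abG.
have [j Dj]: exists j, ('Res[N] 'chi_k = 'chi_j)%R.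
  by apply/irrP/lin_char_irr/cfRes_lin_char.
rewrite Dj -irr0 cfdot_irr eq_sym -irr_eq1 -Dj.
have [sNk | nsNk] := boolP (N \subset cfker ('chi_k)%R).
  by rewrite cfRes_sub_ker // lin_char1 // scale1r eqxx scale1r.
case: eqP => [res1 | _]; last by rewrite scale0r.
case/negP: nsNk; apply/setIidPl.
by rewrite -(cfker_Res sNG (irr_char k)) res1 cfker_cfun1.
Qed.

(** The subgroups [H i] form a partition of [G] in the group-theoretic sense.
    The hypothesis on kernels makes it self-dual: the groups of characters
    trivial on each [H i] form a partition of the dual group. The common index
    [m] is what makes the sums of characters constant on unions of several
    [(H i)^#]. *)
Lemma subgroup_partition_supercharacter_theory (gT : finGroupType) (G : {group gT})
    (n m : nat) (H : 'I_n -> {group gT}) (P : {set {set 'I_n}}) :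
    abelian G -> (forall i, H i :!=: 1) -> (forall i, H i \proper G) ->
    (forall i j x, x \in (H i)^# -> x \in H j -> i = j) ->
    \bigcup_i (H i)^# = G^# -> (forall i, #|G : H i| = m) ->
    (forall k : Iirr G, (k != 0)%R -> exists i, cfker ('chi_k)%R = H i) ->
    partition P [set: 'I_n] ->
  partition [set punctured_union H J | J in P] G^# /\
  exists (X : {set {set Iirr G}}) (K : {set {set gT}}),
    supercharacter_theory G X K /\
    K :\ [set 1] = [set punctured_union H J | J in P].
Proof.
move=> abG ntH prH tiH coverH indexH kerH P_part.
have sHG i := proper_sub (prH i).
have nHG i : H i <| G by rewrite -sub_abelian_normal.
have [||partN injN] := bigcup_partition _ _ P_part (D := fun i => (H i)^#).
- move=> i j neq_ij; apply/pred0P=> x /=; apply: contraNF neq_ij.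
  by case/andP=> Hix /setD1P[_ Hjx]; apply/eqP; apply: tiH Hix Hjx.
- by move=> i; rewrite setD_eq0 subG1.
rewrite coverH in partN; split=> //.
have eqH i j : H i \subset H j -> i = j.
  move=> sij; have /trivgPn[x Hix ntx] := ntH i.
  by apply: (tiH i j x); rewrite ?inE ?ntx // (subsetP sij).
pose D i := [set k : Iirr G | (k != 0)%R & H i \subset cfker ('chi_k)%R].
have disD i j: i != j -> [disjoint D i & D j].
  move=> neq_ij; apply/pred0P=> k /=; rewrite !inE; apply: contraNF neq_ij.
  case/andP=> /andP[nzk sik] /andP[_ sjk]; have [l Dl] := kerH k nzk.
  by rewrite Dl in sik sjk; rewrite (eqH _ _ sik) (eqH _ _ sjk).
(* Otherwise only the principal character would be trivial on H i, while the
   kernels of all characters trivial on H i intersect in H i. *)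
have ntD i: D i != set0.
  apply: contraTneq (prH i) => Di0.
  rewrite properE negb_and -(cap_cfker_normal (nHG i)) negbK.
  apply/orP; right; apply/bigcapsP=> k sHk; rewrite subGcfker.
  by have:= in_set0 k; rewrite -Di0 inE sHk andbT => /negbFE.
have coverD: \bigcup_i D i = ~: [set 0%R].
  apply/setP=> k; rewrite !inE.
  apply/bigcupP/idP=> [[i _ /setIdP[]] // | nzk].
  by have [i Di] := kerH k nzk; exists i; rewrite // inE nzk Di /=.
have [partD injD] := bigcup_partition disD ntD P_part.
rewrite coverD in partD.
pose KN := [set punctured_union H J | J in P].
pose XD := [set \bigcup_(i in J) D i | J : {set 'I_n} in P].
have coverN : cover KN = G^# := cover_partition partN.
have KN1: [set 1] \notin KN.
  apply/negP=> KN1; have: 1 \in cover KN.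
    by apply/bigcupP; exists [set 1]; rewrite ?set11.
  by rewrite coverN setD11.
have partK: partition ([set 1] |: KN) G.
  rewrite -(setD1K (group1 G)); apply: partitionU1 => //.
    by apply/set0Pn; exists 1; rewrite set11.
  by rewrite disjoints1 setD11.
have XD0: [set 0%R] \notin XD.
  apply/negP=> XD0; have: 0%R \in cover XD.
    by apply/bigcupP; exists [set 0%R]; rewrite ?set11.
  by rewrite (cover_partition partD) !inE eqxx.
have partX: partition ([set 0%R] |: XD) [set: Iirr G].
  rewrite -(setUCr [set 0%R : Iirr G]); apply: partitionU1 => //.
    by apply/set0Pn; exists 0%R; rewrite set11.
  by rewrite disjoints1 !inE eqxx.
exists ([set 0%R] |: XD), ([set 1] |: KN); split; last by rewrite setU1K.
split=> //.
- by rewrite !cardsU1 XD0 KN1 !card_in_imset.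
- by rewrite setU11.
move=> Y /setU1P[-> | /imsetP[J PJ ->]].
  exists 1%R; rewrite cfun1_char oner_neq0; split=> // [k | C KC x y Cx Cy].
    by rewrite -irr0 constt_irr !inE.
  have sCG: C \subset G by rewrite -(cover_partition partK) (bigcup_max C).
  by rewrite !cfun1E !(subsetP sCG).
pose xi : 'CF(G) := (\sum_(k in \bigcup_(i in J) D i) 'chi_k)%R.
have sumD i : (\sum_(k in D i) 'chi_k = m%:R *: '1_(H i) - 1 :> 'CF(G))%R.
  rewrite -(indexH i) -sum_irr_cfker_sub // [in RHS](bigD1 0%R) ?cfker_irr0 //=.
  by rewrite irr0 addrAC subrr add0r; apply: eq_bigl => k; rewrite inE andbC.
have xiE x : x \in G^# ->
    (xi x = m%:R *+ (x \in punctured_union H J) - #|J|%:R)%R.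
  move=> G1x; have /setD1P[_ Gx] := G1x.
  have: x \in \bigcup_i (H i)^# by rewrite coverH.
  case/bigcupP=> j _ Hjx.
  have Hx i : (x \in H i) = (i == j).
    by apply/idP/eqP=> [/(tiH _ _ _ Hjx) // | ->]; case/setD1P: Hjx.
  have ->: (x \in punctured_union H J) = (j \in J).
    apply/bigcupP/idP=> [[i Ji /setD1P[_]] | Jj]; last by exists j.
    by rewrite Hx => /eqP <-.
  rewrite /xi big_disjoint_bigcup // sum_cfunE.
  rewrite (eq_bigr (fun i => m%:R *+ (i == j) - 1)%R) => [|i _]; last first.
    rewrite sumD !cfunE cfuniE // Hx cfun1E Gx.
    by case: (i == j); rewrite ?mulr1 ?mulr0.
  rewrite sumrB sumr_const; congr (_ - _)%R.
  have [Jj | nJj] := boolP (j \in J).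
    rewrite (bigD1 j) //= eqxx big1 ?addr0 // => i /andP[_ /negPf->].
    by rewrite mulr0n.
  by rewrite big1 // => i Ji; rewrite (negPf (memPn nJj i Ji)).
have constt_xi : irr_constt xi =i \bigcup_(i in J) D i.
  exact: irr_constt_sum_irr.
exists xi; split=> [|||C].
- by apply: rpred_sum => k _; apply: irr_char.
- have /set0Pn[j Jj]: J != set0.
    by case/and3P: P_part => _ _; apply: contraNneq => <-.
  have /set0Pn[k Dk] := ntD j.
  have: k \in irr_constt xi by rewrite constt_xi; apply/bigcupP; exists j.
  by apply: contraTneq => ->; rewrite irr_consttE cfdot0l eqxx.
- by move=> k; rewrite constt_xi.
case/setU1P=> [-> x y /set1P-> /set1P-> // | KC x y Cx Cy].
have sCG: C \subset G^# by rewrite -coverN (bigcup_max C).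
have KJ : punctured_union H J \in KN by apply: imset_f.
have tiN : trivIset KN by case/and3P: partN.
have memJ z : z \in C -> (z \in punctured_union H J) = (C == punctured_union H J).
  move=> Cz; apply/idP/eqP=> [Jz | <- //].
  by rewrite -(def_pblock tiN KC Cz) (def_pblock tiN KJ Jz).
by rewrite !xiE ?memJ ?(subsetP sCG).
Qed.

(** The center of an irreducible character of an abelian group is the whole
    group, and its quotient by the kernel embeds in the multiplicative group of
    the field of values. *)
Lemma cyclic_abelian_quotient_cfker (gT : finGroupType) (G : {group gT})
    (k : Iirr G) : abelian G -> cyclic (G / cfker ('chi_k)%R).
Proof.
move=> abG; have := cfcenter_cyclic ('chi_k)%R.
rewrite cfcenter_eq_center.
by have /center_idP->: abelian (G / cfker ('chi_k)%R) by rewrite quotient_abelian.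
Qed.

Lemma abelem_Zp_pair (p : nat) :
  prime p -> p.-abelem [set: 'Z_p * 'Z_p] /\ #|[set: 'Z_p * 'Z_p]| = (p ^ 2)%N.
Proof.
move=> p_pr; split; last first.
  by rewrite cardsT card_prod !card_ord !Zp_cast ?prime_gt1 // mulnn.
apply/abelemP=> //; split=> [|[x y] _].
  by apply/centsP=> -[x1 y1] _ [x2 y2] _; congr (_, _); apply: Zp_mulgC.
have expZ (z : 'Z_p) : z ^+ p = 1.
  apply: ord_inj; rewrite Zp_expg /=.
  by rewrite -[X in (_ * X)%N](Zp_cast (prime_gt1 p_pr)) modnMl.
have expE n : (x, y) ^+ n = (x ^+ n, y ^+ n).
  by elim: n => [|n IHn] //; rewrite !expgS IHn.
by rewrite expE !expZ.
Qed.

Lemma proper_subgroup_card (gT : finGroupType) (p : nat) (G K : {group gT}) :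
  prime p -> #|G| = (p ^ 2)%N -> K :!=: 1 -> K \proper G -> #|K| = p.
Proof.
move=> p_pr oG ntK prKG.
have: #|K| %| p ^ 2 by rewrite -oG cardSg ?proper_sub.
case/dvdn_pfactor=> // m le_m2 oK.
have := proper_card prKG; rewrite oG oK ltn_exp2l ?prime_gt1 // ltnS.
case: m {le_m2} oK => [|[|m]] // oK _.
by move: ntK; rewrite trivg_card1 oK eqxx.
Qed.

Theorem lemma5p1 (p : nat) (p_prime : prime p)
    (gT : finGroupType) (G : {group gT})
    (isoG : G \isog [set: 'Z_p * 'Z_p])
    (H : 'I_p.+1 -> {group gT}) (H_inj : injective H)
    (H_enum : forall K : {group gT},
       (exists i, H i = K) <-> (K :!=: 1 /\ K \proper G))
    (P : {set {set 'I_p.+1}}) (P_part : partition P [set: 'I_p.+1]) :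
  partition [set punctured_union H I | I in P] G^# /\
  exists (X : {set {set Iirr G}}) (K : {set {set gT}}),
    supercharacter_theory G X K /\
    K :\ [set 1] = [set punctured_union H I | I in P].
Proof.
have [abelZ oZ] := abelem_Zp_pair p_prime.
have abelG: p.-abelem G by rewrite (isog_abelem isoG).
have oG: #|G| = (p ^ 2)%N by rewrite (card_isog isoG).
have abG := abelem_abelian abelG.
have ncycG: ~~ cyclic G by rewrite (abelem_cyclic abelG) oG pfactorK.
have ntH i: H i :!=: 1 by have [/(_ (ex_intro _ i erefl))[]] := H_enum (H i).
have prH i: H i \proper G by have [/(_ (ex_intro _ i erefl))[]] := H_enum (H i).
have sHG i := proper_sub (prH i).
have oH i: #|H i| = p by apply: (proper_subgroup_card p_prime oG).
apply: (subgroup_partition_supercharacter_theory (m := p)) => // [i j x Hix Hjx | | i | k nzk].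
- case/setD1P: Hix => ntx Hix.
  suffices sij: H i \subset H j.
    by apply/H_inj/val_inj/eqP; rewrite /= eqEcard sij !oH /=.
  apply: contraR ntx => nsij.
  by rewrite -in_set1 -set1gE -(prime_TIg _ nsij) ?oH // inE Hix.
- apply/setP=> x; apply/bigcupP/setD1P=> [[i _ /setD1P[ntx Hix]] | [ntx Gx]].
    by rewrite (subsetP (sHG i)).
  (* The subgroup generated by x is proper since G is not cyclic. *)
  have [_ []] := H_enum <[x]>%G; last first.
    by move=> i Di; exists i; rewrite // !inE ntx Di /= cycle_id.
  rewrite cycle_eq1 properEneq cycle_subG Gx andbT; split=> //.
  by apply: contraNneq ncycG => <-; apply: cycle_cyclic.
- by rewrite -divgS // oG oH mulKn ?prime_gt0.
have [_ []] := H_enum [group of cfker ('chi_k)%R]; last first.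
  by move=> i Di; exists i; rewrite Di.
split; last by rewrite properE cfker_sub subGcfker.
apply: contraNneq ncycG => k1.
have := cyclic_abelian_quotient_cfker k abG; rewrite [cfker _]k1.
by rewrite -(isog_cyclic (quotient1_isog G)).
Qed.
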